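(* There exist positive numbers $\{\kappa_\rho:\rho\in(0,1/2]\}$ (independent of $d$ and $\sigma$) such that for the monotone cone $M=\{\theta\in\mathbb{R}^d:\theta_1\le\theta_2\le\cdots\le\theta_d\}$ and the subspace $L=\{0\}$ or $L=\mathrm{span}(\mathbf 1)$, where $\mathbf 1=(1,\dots,1)\in\mathbb{R}^d$, we have $$\inf_\psi\mathcal{E}(\psi;L,M,\epsilon)\ \ge\ \rho\qquad\text{whenever } \epsilon^2\le\kappa_\rho\,\sigma^2\sqrt{\log(ed)},$$ where the infimum is over all measurable tests $\psi:\mathbb{R}^d\to\{0,1\}$.
   Context: Model: one observes $y=\theta+\sigma g\in\mathbb{R}^d$ with $\theta$ unknown, $g\sim N(0,I_d)$ and $\sigma>0$ known; $\mathbb{E}_\theta$ is expectation under $y\sim N(\theta,\sigma^2I_d)$. For closed convex cones $C_1\subset C_2$ and $\epsilon>0$, the uniform error of a test $\psi$ is $$\mathcal{E}(\psi;C_1,C_2,\epsilon) = \sup_{\theta\in C_1}\mathbb{E}_\theta[\psi(y)] + \sup_{\theta\in C_2\setminus B_2(C_1;\epsilon)}\mathbb{E}_\theta[1-\psi(y)],$$ where $B_2(C_1;\epsilon) = \{\theta : \min_{u\in C_1}\|\theta-u\|_2\le\epsilon\}$. Here $e$ in $\log(ed)$ is Euler's number.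
   Formalization: For L = span(1) the formal theorem assumes d ≥ 2: when d = 1 we have M = L = ℝ, so there is no alternative, and the test ψ = 0 has error at most 0 < ρ, making the claim false in that case. *)

(* Defs.v *)
From HB Require Import structures.
From mathcomp Require Import all_boot all_order all_algebra.
From mathcomp Require Import all_classical all_reals all_analysis.

Set Implicit Arguments.
Unset Strict Implicit.
Unset Printing Implicit Defensive.

Import Order.TTheory GRing.Theory Num.Theory.
Import numFieldNormedType.Exports.

Local Open Scope classical_set_scope.
Local Open Scope ring_scope.

(* R^d, with the product of the d Borel sigma-algebras of R, i.e. the Borel
   sigma-algebra of R^d. *)
Definition Rvec (R : realType) (d : nat) := d.-tuple (measurableTypeR R).

Section tuple_product.
Context {disp : measure_display} {T : measurableType disp} {R : realType}.

Definition pair_cons (n : nat) (x : T * n.-tuple T) : n.+1.-tuple T :=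
  [tuple of x.1 :: x.2].

Lemma measurable_pair_cons (n : nat) : measurable_fun setT (@pair_cons n).
Proof. exact: measurable_cons. Qed.

HB.instance Definition _ (n : nat) :=
  isMeasurableFun.Build _ _ _ _ (@pair_cons n) (@measurable_pair_cons n).

(* The product probability P_0 x ... x P_(n-1), characterised by tuple_probE. *)
Fixpoint tuple_prob (n : nat) :
    ('I_n -> probability T R) -> probability (n.-tuple T) R :=
  if n is m.+1 then fun P =>
    distribution (P ord0 \x tuple_prob (fun i : 'I_m => P (lift ord0 i)))%E
                 (@pair_cons m)
  else fun _ => dirac [tuple].

Lemma tuple_probE (n : nat) (P : 'I_n -> probability T R) (A : 'I_n -> set T) :
  (forall i, measurable (A i)) ->
  tuple_prob P [set x : n.-tuple T | forall i, A i (tnth x i)] =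
  (\prod_(i < n) P i (A i))%E.
Proof.
elim: n P A => [|n IH] P A mA.
  by rewrite big_ord0 /= diracE mem_set//= => -[].
rewrite big_ord_recl -(IH (fun i => P (lift ord0 i)) (A \o lift ord0)) //=.
rewrite -product_measure1E//; last first.
  rewrite (_ : mkset _ = \bigcap_(i in [set: 'I_n])
      ((@tnth n T)^~ i @^-1` (A (lift ord0 i)))); last first.
    by apply/seteqP; split => x /= h i; [move=> _|]; apply: h.
  apply: fin_bigcap_measurable => // i _.
  by rewrite -[X in measurable X]setTI; exact: measurable_tnth.
rewrite /distribution /pushforward; congr (_ _).
apply/seteqP; split => -[x y] /=.
  move=> h; split; first exact: (h ord0).
  by move=> i; have := h (lift ord0 i); rewrite tnthS.
move=> [h0 h] i; case: (unliftP ord0 i) => [j ->|->] //.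
by rewrite tnthS; exact: h.
Qed.

End tuple_product.

Section testing.
Context {R : realType} {d : nat}.
Implicit Types (theta u v : Rvec R d) (C : set (Rvec R d)) (sigma eps : R).

(* N(theta, sigma^2 I_d); the second argument of normal_prob is the standard
   deviation. *)
Definition gaussian theta sigma : probability (Rvec R d) R :=
  tuple_prob (fun i => normal_prob (tnth theta i) sigma).

Definition dist2 u v : R :=
  Num.sqrt (\sum_(i < d) (tnth u i - tnth v i) ^+ 2).

(* B_2(C; eps), the condition min_(u in C) dist2 theta u <= eps being written
   with a minimiser u. *)
Definition ball2 C eps : set (Rvec R d) :=
  [set theta | exists2 u, C u &
     (forall v, C v -> dist2 theta u <= dist2 theta v) /\ dist2 theta u <= eps].

Definition test := {mfun Rvec R d >-> bool}.

(* The suprema are in \bar R, with sup of the empty set = -oo; the formula is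
   meant for C1 and C2 minus ball2 C1 eps both nonempty. *)
Definition uniform_error (psi : test) C1 C2 sigma eps : \bar R :=
  (ereal_sup [set 'E_(gaussian theta sigma)[(fun y => (psi y)%:R)%R]
             | theta in C1] +
   ereal_sup [set 'E_(gaussian theta sigma)[(fun y => 1 - (psi y)%:R)%R]
             | theta in C2 `\` ball2 C1 eps])%E.

Definition minimax_error C1 C2 sigma eps : \bar R :=
  ereal_inf [set uniform_error psi C1 C2 sigma eps | psi in [set: test]].

Definition monotone_cone : set (Rvec R d) :=
  [set theta : Rvec R d | sorted <=%R theta].

Definition zero_space : set (Rvec R d) := [set (nseq_tuple d 0 : Rvec R d)].

Definition span1 : set (Rvec R d) :=
  [set (nseq_tuple d c : Rvec R d) | c in [set: R]].

End testing.
Arguments test : clear implicits.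
Arguments monotone_cone : clear implicits.
Arguments zero_space : clear implicits.
Arguments span1 : clear implicits.

(* Main.v *)
Require Import Defs.
From mathcomp Require Import all_boot all_order all_algebra.
From mathcomp Require Import all_classical all_reals all_analysis.
From mathcomp Require Import measurable_realfun ring lra zify.

(* The null mean 0 is tested against the uniform mixture of the laws
   N(theta_s, sigma^2 I) over a finite family of monotone means theta_s. By a
   second-moment bound the total error is at least 1/2 as soon as the average of
   exp(<theta_s, theta_t> / sigma^2) over pairs (s, t) is at most 5/4, so a
   constant kappa serves all rho <= 1/2.
   The vectors u_k = 2^-k 1[the last 4^k coordinates] are monotone and satisfy
   <u_j, u_k> = 2^-|j - k|, so their Gram matrix has row sums at most 3. Cut the
   first r^2 exponents into r groups of r and let theta_s be sigma / 8 times the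
   sum of one u_k per group, s recording the choices. Then
   |theta_s|^2 >= (sigma / 8)^2 r, with r of order sqrt(log(e d)), while the
   average over t factorises over the groups and is bounded by a constant. *)

Set Implicit Arguments.
Unset Strict Implicit.

Import Order.TTheory GRing.Theory Num.Theory.
Local Open Scope classical_set_scope.
Local Open Scope ring_scope.

(** * Change of measure between Gaussian laws with a common variance *)

Section likelihood_ratio.
Context {R : realType}.
Local Notation mu := (@lebesgue_measure R).

(** Radon-Nikodym change of variables: the derivative and [normal_pdf] have the same integral over
    every measurable set, hence agree almost everywhere. *)
Lemma integral_normal_prob (m s : R) (f : measurableTypeR R -> \bar R) :
  measurable_fun setT f -> (forall x, 0 <= f x)%E ->
  (\int[normal_prob m s]_x f x = \int[mu]_x (f x * (normal_pdf m s x)%:E))%E.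
Proof.
move=> mf f0; have dom := @normal_prob_dominates R m s.
have mpdf : measurable_fun setT (fun x => (normal_pdf m s x)%:E).
  by apply/measurable_EFinP; exact: measurable_normal_pdf.
rewrite -(Radon_Nikodym_SigmaFinite.change_of_variables dom) //.
have iRN := Radon_Nikodym_SigmaFinite.f_integrable dom.
apply: ae_eq_integral => //.
- by apply: emeasurable_funM => //; exact: measurable_int iRN.
- exact: emeasurable_funM.
- apply: (ae_eq_comp2 (fun x y => f x * y)%E).
  apply: integral_ae_eq => // E _ mE.
  by rewrite -Radon_Nikodym_SigmaFinite.f_integral.
Qed.

(** The density of N(m, s^2) with respect to N(0, s^2). *)
Definition lr1 (s m x : R) : R :=
  expR (m * x / s ^+ 2 - m ^+ 2 / (s ^+ 2 *+ 2)).

Lemma measurable_lr1 s m : measurable_fun setT (lr1 s m).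
Proof.
apply: measurableT_comp => //; apply: measurable_funB => //.
by apply: measurable_funM => //; apply: measurable_funM.
Qed.

Lemma integral_normal_lr1 (m s : R) (f : measurableTypeR R -> \bar R) : 0 < s ->
  measurable_fun setT f -> (forall x, 0 <= f x)%E ->
  (\int[normal_prob m s]_x f x =
   \int[normal_prob 0 s]_x (f x * (lr1 s m x)%:E))%E.
Proof.
move=> s0 mf f0.
have mflr : measurable_fun setT (fun x => f x * (lr1 s m x)%:E)%E.
  apply: (emeasurable_funM mf); apply/measurable_EFinP; exact: measurable_lr1.
have flr0 x : (0 <= f x * (lr1 s m x)%:E)%E.
  by rewrite mule_ge0// lee_fin expR_ge0.
apply: etrans (integral_normal_prob m s mf f0) _.
apply: etrans _ (esym (integral_normal_prob 0 s mflr flr0)).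
apply: eq_integral => x _; rewrite -muleA -EFinM; congr (_ * _%:E)%E.
have sN0 : s != 0 by rewrite gt_eqF.
rewrite (normal_pdfE _ sN0) (normal_pdfE _ sN0) mulrCA; congr (_ * _).
rewrite /normal_fun /lr1 -expRD; congr expR; field; lra.
Qed.

Definition lr {d} (s : R) (m : 'I_d -> R) (y : Rvec R d) : R :=
  \prod_(i < d) lr1 s (m i) (tnth y i).

Lemma lr_ge0 d s (m : 'I_d -> R) y : 0 <= lr s m y.
Proof. by apply: prodr_ge0 => i _; exact: expR_ge0. Qed.

Lemma measurable_lr d s (m : 'I_d -> R) : measurable_fun setT (lr s m).
Proof.
apply: measurable_prod => i _; apply: measurableT_comp.
  exact: measurable_lr1.
exact: measurable_tnth.
Qed.

Lemma integral_tuple_prob_cons n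
    (P : 'I_n.+1 -> probability (measurableTypeR R) R)
    (f : Rvec R n.+1 -> \bar R) :
  measurable_fun setT f -> (forall y, 0 <= f y)%E ->
  (\int[tuple_prob P]_y f y = \int[P ord0]_x
     \int[tuple_prob (fun i => P (lift ord0 i))]_y f (pair_cons (x, y)))%E.
Proof.
move=> mf f0.
rewrite /= ge0_integral_distribution// fubini_tonelli1//.
  by apply: measurableT_comp => //; exact: measurable_pair_cons.
by move=> x; exact: f0.
Qed.

(** Induction on [d] by Tonelli: the induction hypothesis changes the law of the tail inside,
    [integral_normal_lr1] that of the first coordinate outside. *)
Lemma integral_tuple_prob_lr d (s : R) (m : 'I_d -> R) (f : Rvec R d -> \bar R) :
  0 < s -> measurable_fun setT f -> (forall y, 0 <= f y)%E ->
  (\int[tuple_prob (fun i => normal_prob (m i) s)]_y f y =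
   \int[tuple_prob (fun i : 'I_d => normal_prob 0 s)]_y (f y * (lr s m y)%:E))%E.
Proof.
move=> s0; elim: d m f => [|d IH] m f mf f0.
  by apply: eq_integral => y _; rewrite /lr big_ord0 mule1.
have mflr : measurable_fun setT (fun y => f y * (lr s m y)%:E)%E.
  by apply: emeasurable_funM => //; apply/measurable_EFinP; exact: measurable_lr.
have mcons x : measurable_fun setT (fun y : Rvec R d => pair_cons (x, y)).
  exact: (measurable_fun_pair2 _ (@measurable_pair_cons _ _ d)).
have flr0 y : (0 <= f y * (lr s m y)%:E)%E.
  by rewrite mule_ge0// lee_fin lr_ge0.
pose P (i : 'I_d.+1) : probability (measurableTypeR R) R := normal_prob (m i) s.
pose P0 (i : 'I_d.+1) : probability (measurableTypeR R) R := normal_prob 0 s.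
apply: etrans (integral_tuple_prob_cons P mf f0) _.
apply: etrans _ (esym (integral_tuple_prob_cons P0 mflr flr0)).
transitivity (\int[normal_prob (m ord0) s]_x
   \int[tuple_prob (fun i : 'I_d => normal_prob 0 s)]_y
   (f (pair_cons (x, y)) * (lr s (fun i => m (lift ord0 i)) y)%:E))%E.
  apply: eq_integral => x _.
  exact: (IH (fun i => m (lift ord0 i)) _
    (measurableT_comp mf (mcons x)) (fun=> f0 _)).
rewrite integral_normal_lr1//; last first.
- by move=> x; apply: integral_ge0 => y _; rewrite mule_ge0// lee_fin lr_ge0.
- pose g (z : measurableTypeR R * Rvec R d) :=
    (f (pair_cons z) * (lr s (fun i => m (lift ord0 i)) z.2)%:E)%E.
  (* The one-dimensional change of measure is applied to the inner integral, whose measurability in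
     [x] comes from Tonelli. *)
  apply: (@measurable_fun_fubini_tonelli_F _ _ _ _ _
    (tuple_prob (fun i : 'I_d => normal_prob 0 s)) g).
    apply: emeasurable_funM.
      by apply: measurableT_comp => //; exact: measurable_pair_cons.
    apply/measurable_EFinP; apply: measurableT_comp; first exact: measurable_lr.
    exact: measurable_snd.
  by move=> z; rewrite /g mule_ge0// lee_fin lr_ge0.
apply: eq_integral => x _; rewrite -ge0_integralZr//; last 3 first.
- apply: emeasurable_funM; first exact: (measurableT_comp mf).
  by apply/measurable_EFinP; exact: measurable_lr.
- by move=> y _; rewrite mule_ge0// lee_fin lr_ge0.
- by rewrite lee_fin expR_ge0.
apply: eq_integral => y _; rewrite -muleA -EFinM; congr (_ * _%:E)%E.
rewrite {2}/lr big_ord_recl mulrC; congr (_ * _).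
by apply: eq_bigr => i _; rewrite tnthS.
Qed.

(** Completing the square. What remains is again a likelihood ratio, so cross moments under the null
    reduce to the constant in front. *)
Lemma lrM d s (m m' : 'I_d -> R) y : 0 < s -> lr s m y * lr s m' y =
  expR ((\sum_i m i * m' i) / s ^+ 2) * lr s (fun i => m i + m' i) y.
Proof.
move=> s0; rewrite mulr_suml expR_sum -!big_split/=; apply: eq_bigr => i _.
rewrite /lr1 -!expRD; congr expR; field; lra.
Qed.

End likelihood_ratio.

(** * Second-moment bound for a simple null against a finite mixture *)

Section mixture_bound.
Context {R : realType} {d : nat}.
Local Notation P0 s := (tuple_prob (fun i : 'I_d => normal_prob (0 : R) s)).

Lemma gaussian0 (s : R) : gaussian (nseq_tuple d 0 : Rvec R d) s = P0 s.
Proof.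
by rewrite /gaussian; congr tuple_prob; apply/funext => i; rewrite tnth_nseq.
Qed.

Lemma integral_gaussian_lr (theta : Rvec R d) (s : R) (f : Rvec R d -> R) :
  0 < s -> measurable_fun setT f -> (forall y, 0 <= f y) ->
  (\int[gaussian theta s]_y (f y)%:E =
   \int[P0 s]_y (lr s (tnth theta) y * f y)%:E)%E.
Proof.
move=> s0 mf f0.
have mf' : measurable_fun setT (fun y : Rvec R d => (f y)%:E).
  exact/measurable_EFinP.
apply: etrans (integral_tuple_prob_lr (tnth theta) s0 mf' _) _.
  by move=> y; rewrite lee_fin.
by apply: eq_integral => y _; rewrite -EFinM mulrC.
Qed.

Lemma integral_lr (m : 'I_d -> R) (s : R) : 0 < s ->
  (\int[P0 s]_y (lr s m y)%:E = 1)%E.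
Proof.
move=> s0.
have prob1 (Q : probability (Rvec R d) R) : (\int[Q]_y 1 = 1)%E.
  by have := expectation_cst Q (1 : R); rewrite unlock.
have mcst1 : measurable_fun setT (fun _ : Rvec R d => 1 : \bar R)%E.
  exact: measurable_cst.
rewrite -(prob1 (tuple_prob (fun i => normal_prob (m i) s))).
apply: etrans (esym (integral_tuple_prob_lr m s0 mcst1 (fun=> lee01))).
by apply: eq_integral => y _; rewrite mul1e.
Qed.

Lemma integral_lrM (m m' : 'I_d -> R) (s : R) : 0 < s ->
  (\int[P0 s]_y (lr s m y * lr s m' y)%:E =
   (expR ((\sum_i m i * m' i) / s ^+ 2))%:E)%E.
Proof.
move=> s0; under eq_integral do rewrite lrM// EFinM.
rewrite ge0_integralZl ?integral_lr ?mule1 ?lee_fin ?expR_ge0//.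
  by apply/measurable_EFinP; exact: measurable_lr.
by move=> y _; rewrite lee_fin lr_ge0.
Qed.

Lemma integral_sumZ (P : probability (Rvec R d) R) (K : finType) (c : K -> R)
    (f : K -> Rvec R d -> R) :
  (forall k, measurable_fun setT (f k)) -> (forall k, 0 <= c k) ->
  (forall k y, 0 <= f k y) ->
  (\int[P]_y (\sum_k c k * f k y)%:E = \sum_k (c k)%:E * \int[P]_y (f k y)%:E)%E.
Proof.
move=> mf c0 f0; under eq_integral do rewrite -sumEFin.
rewrite ge0_integral_sum//.
- apply: eq_bigr => k _; under eq_integral do rewrite EFinM.
  rewrite ge0_integralZl ?lee_fin//; first exact/measurable_EFinP.
  by move=> y _; rewrite lee_fin.
- by move=> k; apply/measurable_EFinP; apply: measurable_funM.
- by move=> k y _; rewrite lee_fin mulr_ge0.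
Qed.

Lemma integral_EFinD (P : probability (Rvec R d) R) (f g : Rvec R d -> R) :
  measurable_fun setT f -> measurable_fun setT g ->
  (forall y, 0 <= f y) -> (forall y, 0 <= g y) ->
  (\int[P]_y (f y + g y)%:E = \int[P]_y (f y)%:E + \int[P]_y (g y)%:E)%E.
Proof.
move=> mf mg f0 g0; under eq_integral do rewrite EFinD.
rewrite ge0_integralD//.
- by move=> y _; rewrite lee_fin.
- exact/measurable_EFinP.
- by move=> y _; rewrite lee_fin.
- exact/measurable_EFinP.
Qed.

Lemma fin_num_integral_le1 (P : probability (Rvec R d) R) (f : Rvec R d -> R) :
  measurable_fun setT f -> (forall y, 0 <= f y <= 1) ->
  (\int[P]_y (f y)%:E)%E \is a fin_num.
Proof.
move=> mf f01; have P1 := expectation_cst P (1 : R); rewrite unlock in P1.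
have h0 : (0 <= \int[P]_y (f y)%:E)%E.
  by apply: integral_ge0 => y _; rewrite lee_fin; case/andP: (f01 y).
rewrite ge0_fin_numE// (@le_lt_trans _ _ 1%E) ?ltry// -P1.
apply: ge0_le_integral => //.
- by move=> y _; rewrite lee_fin; case/andP: (f01 y).
- exact/measurable_EFinP.
- by apply/measurable_EFinP; exact: measurable_cst.
- by move=> y _; rewrite lee_fin; case/andP: (f01 y).
Qed.

(** A pointwise inequality, integrated under the null, bounds below the type I error plus the
    average type II error; some [k] does at least as badly as the average. *)
Lemma mixture_lower_bound (K : finType) (theta : K -> Rvec R d) (s : R)
    (psi : test R d) : 0 < s -> (0 < #|K|)%N ->
  \sum_k \sum_l expR ((\sum_i tnth (theta k) i * tnth (theta l) i) / s ^+ 2) <=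
    5 / 4 * #|K|%:R ^+ 2 ->
  exists k : K, ((1 / 2)%:E <=
    'E_(gaussian (nseq_tuple d 0%R : Rvec R d) s)[(fun y => (psi y)%:R)%R] +
    'E_(gaussian (theta k) s)[(fun y => 1 - (psi y)%:R)%R])%E.
Proof.
move=> s0 K0 chi2; rewrite gaussian0 unlock.
pose L k y := lr s (tnth (theta k)) y.
pose phi y : R := (psi y)%:R.
pose w : R := #|K|%:R^-1.
have K0' : 0 < #|K|%:R :> R by rewrite ltr0n.
have w0 : 0 <= w by rewrite invr_ge0 ler0n.
have L0 k y : 0 <= L k y by exact: lr_ge0.
have mL k : measurable_fun setT (L k) by exact: measurable_lr.
have mphi : measurable_fun setT phi.
  by apply: (@measurableT_comp _ _ _ _ _ _ (fun b : bool => b%:R : R)).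
have phi01 y : 0 <= phi y <= 1 by rewrite /phi ler0n lern1 leq_b1.
have phi01' y : 0 <= 1 - phi y <= 1 by case/andP: (phi01 y); lra.
have mphi' : measurable_fun setT (fun y => 1 - phi y).
  by apply: measurable_funB.
have phi0' y : 0 <= 1 - phi y by case/andP: (phi01' y).
pose alpha := fine (\int[P0 s]_y (phi y)%:E)%E.
pose beta k := fine (\int[gaussian (theta k) s]_y (1 - phi y)%:E)%E.
have alphaE : (\int[P0 s]_y (phi y)%:E)%E = alpha%:E.
  by rewrite fineK// fin_num_integral_le1.
have betaE k : (\int[gaussian (theta k) s]_y (1 - phi y)%:E)%E = (beta k)%:E.
  by rewrite fineK//; exact: fin_num_integral_le1.
(* Expanded forms of w Lbar (1 - phi), (w Lbar)^2 and 2 w Lbar with Lbar = sum_k L k; their null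
   integrals are the average type II error, the second moment (at most 5/4) and 2. *)
pose B y := \sum_k w * (L k y * (1 - phi y)).
pose C y := \sum_(p : K * K) (w * w) * (L p.1 y * L p.2 y).
pose T y := \sum_k (2 * w) * L k y.
have B0 y : 0 <= B y.
  by apply: sumr_ge0 => k _; rewrite !mulr_ge0//; case/andP: (phi01' y).
have C0 y : 0 <= C y by apply: sumr_ge0 => p _; rewrite !mulr_ge0.
have T0 y : 0 <= T y by apply: sumr_ge0 => k _; rewrite !mulr_ge0.
have mB : measurable_fun setT B.
  by apply: measurable_sum => k; do 2!apply: measurable_funM => //.
have mC : measurable_fun setT C.
  by apply: measurable_sum => p; do 2!apply: measurable_funM => //.
have mT : measurable_fun setT T.
  by apply: measurable_sum => k; apply: measurable_funM.
have IB : (\int[P0 s]_y (B y)%:E = (\sum_k w * beta k)%:E)%E.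
  rewrite integral_sumZ//; last 2 first.
  - by move=> k; apply: measurable_funM.
  - by move=> k y; rewrite mulr_ge0//; case/andP: (phi01' y).
  rewrite -sumEFin; apply: eq_bigr => k _; rewrite EFinM -betaE.
  by rewrite (integral_gaussian_lr (theta k) s0 mphi' phi0').
have IC : (\int[P0 s]_y (C y)%:E <= (5 / 4)%:E)%E.
  rewrite integral_sumZ//; last 3 first.
  - by move=> p; apply: measurable_funM.
  - by move=> p; rewrite mulr_ge0.
  - by move=> p y; rewrite mulr_ge0.
  under eq_bigr do rewrite integral_lrM// -EFinM.
  rewrite sumEFin lee_fin -mulr_sumr.
  rewrite -(pair_bigA _ (fun k l => expR ((\sum_i tnth (theta k) i *
    tnth (theta l) i) / s ^+ 2)))/=.
  by rewrite -invfM ler_pdivrMl ?mulr_gt0// mulrC -expr2.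
have IT : (\int[P0 s]_y (T y)%:E = 2%:E)%E.
  rewrite integral_sumZ//; last by move=> k; rewrite mulr_ge0.
  under eq_bigr do rewrite integral_lr// mule1.
  rewrite sumEFin sumr_const -(mulr_natr (2 * w)); congr _%:E.
  by rewrite -mulrA [X in _ * X]mulVf ?mulr1// gt_eqF.
(* psi + w Lbar (1 - psi) >= 3/4 - (w Lbar - 1)^2, with the negative terms moved
   to the left so that every integrand is nonnegative *)
have key y : T y <= phi y + B y + C y + 1 / 4.
  pose Lbar := \sum_k L k y.
  have -> : T y = 2 * (w * Lbar) by rewrite /T -mulr_sumr mulrA.
  have -> : B y = (w * Lbar) * (1 - phi y).
    by rewrite /B -mulr_sumr -mulr_suml mulrA.
  have -> : C y = (w * Lbar) ^+ 2.
    rewrite /C -mulr_sumr -(pair_bigA _ (fun k l => L k y * L l y))/=.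
    by under eq_bigr do rewrite -mulr_sumr; rewrite -mulr_suml expr2 mulrACA.
  rewrite /phi; case: (psi y) => /=.
    by have := sqr_ge0 (w * Lbar - 1); nra.
  by have := sqr_ge0 (w * Lbar - 1 / 2); nra.
have main : 2 <= alpha + (\sum_k w * beta k) + 5 / 4 + 1 / 4.
  rewrite -lee_fin -IT.
  apply: (@le_trans _ _ (\int[P0 s]_y (phi y + B y + C y + 1 / 4)%:E)%E).
    apply: ge0_le_integral => //.
    - by move=> y _; rewrite lee_fin.
    - exact/measurable_EFinP.
    - by apply/measurable_EFinP; do !apply: measurable_funD.
    - by move=> y _; rewrite lee_fin.
  have phi0 y : 0 <= phi y by case/andP: (phi01 y).
  have m1 : measurable_fun setT (fun y => phi y + B y) by exact: measurable_funD.
  have m2 : measurable_fun setT (fun y => phi y + B y + C y).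
    exact: measurable_funD.
  have p1 y : 0 <= phi y + B y by rewrite addr_ge0.
  have p2 y : 0 <= phi y + B y + C y by rewrite addr_ge0.
  have q0 : 0 <= 1 / 4 :> R by lra.
  rewrite (integral_EFinD (P0 s) m2 (@measurable_cst _ _ _ _ _ _) p2 (fun=> q0)).
  rewrite (integral_EFinD (P0 s) m1 mC p1 C0).
  rewrite (integral_EFinD (P0 s) mphi mB phi0 B0).
  have Q := expectation_cst (P0 s) (1 / 4 : R); rewrite unlock in Q.
  by rewrite Q alphaE IB -!EFinD; rewrite !EFinD leeD2r// leeD2l.
have [k0 _] : exists k0 : K, true by case/card_gt0P: K0 => k _; exists k.
pose km := [arg max_(k > k0) beta k]%O.
exists km; rewrite alphaE betaE -EFinD lee_fin.
have le_beta k : beta k <= beta km.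
  rewrite /km.
  have [i _ h] := @arg_maxP _ _ _ k0 xpredT beta isT.
  exact: h.
have : \sum_k w * beta k <= beta km.
  rewrite -mulr_sumr ler_pdivrMl//.
  apply: le_trans (ler_sum _ (fun k _ => le_beta k)) _.
  by rewrite sumr_const mulr_natl.
lra.
Qed.

End mixture_bound.

(** * Normalised step vectors at geometric scales and their Gram matrix *)

Section geometric_steps.
Context {R : realType}.

Definition step (d k i : nat) : R := (d - 4 ^ k <= i)%N%:R * 2^-1 ^+ k.

(** Since subtraction on [nat] is truncated, the exponent is |j - k|. *)
Definition step_gram (j k : nat) : R := 2^-1 ^+ ((j - k) + (k - j)).

Lemma step_ge0 d k i : 0 <= step d k i.
Proof. by rewrite mulr_ge0 ?exprn_ge0 ?invr_ge0. Qed.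

Lemma step_nondecreasing d k i j : (i <= j)%N -> step d k i <= step d k j.
Proof.
move=> ij; rewrite ler_wpM2r ?exprn_ge0 ?invr_ge0// ler_nat.
by have [h|_] := leqP (d - 4 ^ k) i; rewrite // (leq_trans h ij).
Qed.

Lemma step_gram_ge0 j k : 0 <= step_gram j k.
Proof. by rewrite exprn_ge0 ?invr_ge0. Qed.

Lemma step_gramC j k : step_gram j k = step_gram k j.
Proof. by rewrite /step_gram addnC. Qed.

Lemma step_gram_diag k : step_gram k k = 1.
Proof. by rewrite /step_gram subnn. Qed.

(** For j <= k the supports are nested, so the sum is 4^j 2^-j 2^-k. The bounds by [d] keep
    [d - 4 ^ k] from being truncated. *)
Lemma sum_step d j k : (4 ^ j <= d)%N -> (4 ^ k <= d)%N ->
  \sum_(i < d) step d j i * step d k i = step_gram j k.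
Proof.
wlog jk : j k / (j <= k)%N => [hwlog jd kd|jd _].
  have [jk|/ltnW kj] := leqP j k; first exact: hwlog.
  by rewrite step_gramC -hwlog//; apply: eq_bigr => i _; rewrite mulrC.
have tail n : (n <= d)%N -> \sum_(i < d) (d - n <= i)%N%:R = n%:R :> R.
  move=> nd; rewrite -natr_sum; congr _%:R.
  rewrite -(big_mkord xpredT (fun i => (d - n <= i)%N : nat)).
  rewrite (big_cat_nat _ (leq_subr n d))//= [X in (X + _)%N]big_nat_cond.
  rewrite [X in (X + _)%N]big1; last first.
    by move=> i; rewrite andbT => /andP[_]; rewrite ltnNge => /negbTE ->.
  rewrite add0n big_nat_cond (eq_bigr (fun=> 1%N)); last first.
    by move=> i; rewrite andbT => /andP[-> _].
  by rewrite -big_nat_cond sum_nat_const_nat muln1 subKn.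
transitivity (\sum_(i < d) (d - 4 ^ j <= i)%N%:R * (2^-1 ^+ j * 2^-1 ^+ k) : R).
  apply: eq_bigr => i _; rewrite /step mulrACA; congr (_ * _).
  rewrite -natrM mulnb; congr (nat_of_bool _)%:R.
  apply: andb_idr; apply: leq_trans; rewrite leq_sub2l// leq_exp2l//.
rewrite -mulr_suml tail// /step_gram.
have -> : (j - k = 0)%N by apply/eqP; rewrite subn_eq0.
have e : 4 ^+ j * 2^-1 ^+ j * 2^-1 ^+ j = 1 :> R.
  by rewrite -!exprMn (_ : 4 * _ * _ = 1) ?expr1n//; lra.
have -> : 2^-1 ^+ k = 2^-1 ^+ (k - j) * 2^-1 ^+ j :> R by rewrite -exprD subnK.
have AC (x y z : R) : x * (y * (z * y)) = x * y * y * z by ring.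
by rewrite add0n natrX AC e mul1r.
Qed.

(** Two geometric series: the entries before the diagonal contribute at most 1, the diagonal 1,
    those after it less than 1. *)
Lemma sum_step_gram_le3 j n : \sum_(k < n) step_gram j k <= 3.
Proof.
have below m : (m <= j)%N -> \sum_(k < m) step_gram j k <= 2^-1 ^+ (j - m).
  elim: m => [|m IH] mj; first by rewrite big_ord0 exprn_ge0 ?invr_ge0.
  rewrite big_ord_recr/=.
  have -> : step_gram j m = 2^-1 ^+ (j - m).
    by rewrite /step_gram; congr (_ ^+ _); lia.
  have := IH (ltnW mj); have -> : (j - m = (j - m.+1).+1)%N by lia.
  rewrite exprS; lra.
have above m : \sum_(k < j + m.+1) step_gram j k <= 3 - 2^-1 ^+ m.
  elim: m => [|m IH].
    rewrite addn1 big_ord_recr/= step_gram_diag.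
    have := below j (leqnn j); rewrite subnn !expr0; lra.
  rewrite addnS big_ord_recr/=.
  have -> : step_gram j (j + m.+1) = 2^-1 ^+ m.+1.
    by rewrite /step_gram; congr (_ ^+ _); lia.
  rewrite exprS; lra.
have [nj|jn] := leqP n j.
  apply: le_trans (below n nj) _; apply: (@le_trans _ _ 1); last by lra.
  by rewrite exprn_ile1 ?invr_ge0// invf_le1; lra.
have -> : n = (j + (n - j).-1.+1)%N by lia.
apply: le_trans (above _) _.
by rewrite lerBlDr lerDl exprn_ge0 ?invr_ge0.
Qed.

(** From exp(-x) >= 1 - x, and (1 - x)(1 + 2x) >= 1 on this interval. *)
Lemma expR_le1D2x (x : R) : 0 <= x <= 1 / 2 -> expR x <= 1 + 2 * x.
Proof.
move=> /andP[x0 x2]; have := expR_ge1Dx (- x); rewrite expRN => h.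
have e0 := expR_gt0 x.
have : (1 - x) * expR x <= 1 by rewrite -ler_pdivlMr// div1r.
nra.
Qed.

(** The largest admissible [r] is taken; its maximality bounds ln d by a multiple of r^2. The top
    exponent in use is [(r * r).-1], and the factor 2 confines supports to the last half of the
    coordinates. *)
Lemma group_count_exists (d : nat) : (1 <= d)%N -> exists r : nat,
  [/\ (1 <= r)%N, (4 ^ (r * r).-1 <= d)%N,
      (2 <= d)%N -> (2 * 4 ^ (r * r).-1 <= d)%N &
      Num.sqrt (ln (expR 1 * d%:R)) <= 4 * r%:R :> R].
Proof.
(* The first disjunct makes [r = 1] admissible even when [d = 1]. *)
move=> d1; pose P r := (r == 1)%N || (2 * 4 ^ (r * r).-1 <= d)%N.
have exP : exists r, P r by exists 1%N.
have bP r : P r -> (r <= d)%N.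
  case/orP=> [/eqP ->//|]; apply: leq_trans.
  have : ((r * r).-1 < 4 ^ (r * r).-1)%N by rewrite ltn_expl.
  nia.
case: (ex_maxnP exP bP) => r Pr rmax.
have r1 : (1 <= r)%N by apply: rmax.
have dr : (d < 2 * 4 ^ (r.+1 * r.+1).-1)%N.
  rewrite ltnNge; apply/negP => h.
  by have : (r.+1 <= r)%N by [apply: rmax; rewrite /P h orbT]; rewrite ltnn.
exists r; split=> //.
- by case/orP: Pr => [/eqP ->//|]; lia.
- by move=> d2; case/orP: Pr => [/eqP ->|//].
have d0 : 0 < d%:R :> R by rewrite ltr0n.
(* Here d < 4^((r+1)^2) <= 4^(4 r^2) because r + 1 <= 2r, and ln 4 <= 3; then 1 + 12 r^2 <=
   (4r)^2. *)
have lnd : ln (d%:R) <= (4 * (r * r))%:R * 3 :> R.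
  apply: (@le_trans _ _ (ln ((4 : R) ^+ (4 * (r * r))))); last first.
    rewrite lnXn ?ltr0n// -(mulr_natl (ln 4)) ler_wpM2l//.
    have -> : (4 : R) = 1 + 3 by lra.
    have h : -1 < 3 :> R by lra.
    exact: le_ln1Dx h.
  rewrite ler_ln ?posrE ?exprn_gt0 ?ltr0n// -natrX ler_nat.
  apply: leq_trans (ltnW dr) _.
  apply: (@leq_trans (4 ^ ((r.+1 * r.+1).-1).+1)); first by rewrite expnS; lia.
  rewrite leq_exp2l//; nia.
have r1' : 1 <= r%:R :> R by rewrite ler1n.
rewrite -[leRHS]ger0_norm; last by lra.
rewrite -sqrtr_sqr ler_wsqrtr// lnM ?posrE ?expR_gt0// expRK.
move: lnd; rewrite !natrM; nra.
Qed.

End geometric_steps.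

(** * The random monotone means: norms, inner products, distance to constants *)

Section signal.
Context {R : realType} (r d : nat).
Implicit Types (c : R) (s t : {ffun 'I_r -> 'I_r}).

(* mxvec_index splits the exponents k < r * r into r groups of r; s picks one
   exponent in each group. *)
Definition level s (g : 'I_r) : 'I_(r * r) := mxvec_index g (s g).

Definition signal c s : Rvec R d :=
  [tuple c * \sum_g step d (level s g) i | i < d].

Lemma tnth_signal c s i : tnth (signal c s) i = c * \sum_g step d (level s g) i.
Proof. by rewrite tnth_mktuple. Qed.

Lemma signal_monotone c s : 0 <= c -> monotone_cone R d (signal c s).
Proof.
move=> c0; rewrite /monotone_cone/=.
apply/(sortedP 0) => i; rewrite size_tuple ?card_ord => id.
have id' := ltnW id.
have -> : nth 0 (signal c s) i = tnth (signal c s) (Ordinal id').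
  by rewrite (tnth_nth 0).
have -> : nth 0 (signal c s) i.+1 = tnth (signal c s) (Ordinal id).
  by rewrite (tnth_nth 0).
rewrite !tnth_signal ler_wpM2l//.
by apply: ler_sum => g _; apply: step_nondecreasing => /=.
Qed.

Context (level_le : forall k : 'I_(r * r), (4 ^ k <= d)%N).

Lemma sum_signal c s t :
  \sum_i tnth (signal c s) i * tnth (signal c t) i =
  c ^+ 2 * \sum_g \sum_h step_gram (level s g) (level t h).
Proof.
under eq_bigr do rewrite !tnth_signal mulrACA -expr2 mulr_suml.
rewrite -mulr_sumr exchange_big/=; congr (_ * _); apply: eq_bigr => g _.
under eq_bigr do rewrite mulr_sumr.
rewrite exchange_big/=; apply: eq_bigr => h _.
exact: (sum_step (level_le (level s g)) (level_le (level t h))).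
Qed.

(** Only the [r] diagonal terms are kept, each equal to 1; the others are nonnegative. *)
Lemma sqnorm_signal_ge c s :
  c ^+ 2 * r%:R <= \sum_i tnth (signal c s) i ^+ 2.
Proof.
under eq_bigr do rewrite expr2; rewrite sum_signal ler_wpM2l ?sqr_ge0//.
rewrite -[X in X%:R]card_ord -sumr_const; apply: ler_sum => g _.
rewrite (bigD1 g)//= step_gram_diag lerDl.
by apply: sumr_ge0 => h _; exact: step_gram_ge0.
Qed.

Lemma sum_level_gram_le3 (q : nat) :
  \sum_(h < r) \sum_(j < r) step_gram q (mxvec_index h j : 'I_(r * r)) <= 3 :> R.
Proof.
rewrite pair_bigA/=; apply: le_trans (sum_step_gram_le3 q (r * r)).
rewrite le_eqVlt; apply/orP; left; apply/eqP.
rewrite (reindex _ (curry_mxvec_bij r r))/=.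
by apply: eq_bigr => -[h j] _.
Qed.

(* Given s, the exponential factorises over the groups of t, whose choices are
   free, so that only the row sums of the Gram matrix matter. *)
Lemma sum_exp_signal c s : (0 < r)%N -> 0 <= c <= 1 / 12 ->
  \sum_t expR (c * \sum_g \sum_h step_gram (level s g) (level t h)) <=
  (1 + 12 * c) * #|{ffun 'I_r -> 'I_r}|%:R.
Proof.
move=> r0 /andP[c0 c6]; have rR : 0 < r%:R :> R by rewrite ltr0n.
pose H (h j : 'I_r) : R :=
  \sum_g step_gram (level s g) (mxvec_index h j : 'I_(r * r)).
have H0 h j : 0 <= H h j by apply: sumr_ge0 => g _; exact: step_gram_ge0.
(* The levels chosen by [s] lie in different groups, so this is part of one full row of the Gram
   matrix. *)
have H3 h j : H h j <= 3.
  apply: le_trans (sum_level_gram_le3 (mxvec_index h j : 'I_(r * r))).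
  apply: ler_sum => g _; rewrite (bigD1 (s g))//= step_gramC lerDl.
  by apply: sumr_ge0 => k _; exact: step_gram_ge0.
pose T h := \sum_j H h j.
have T3 : \sum_h T h <= 3 * r%:R.
  rewrite /T /H; under eq_bigr do rewrite exchange_big/=.
  rewrite exchange_big/=.
  apply: le_trans (ler_sum _ (fun g _ => sum_level_gram_le3 (level s g))) _.
  by rewrite sumr_const card_ord mulr_natr.
have T0 : 0 <= \sum_h T h by do 2!apply: sumr_ge0 => ? _.
rewrite (eq_bigr (fun t : {ffun 'I_r -> 'I_r} =>
    \prod_h expR (c * H h (t h)))); last first.
  by move=> t _; rewrite exchange_big mulr_sumr expR_sum.
rewrite -(bigA_distr_bigA (fun h j => expR (c * H h j))).
(* Each factor is linearised by exp(x) <= 1 + 2x, summed over [j], and put back in an exponential by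
   1 + x <= exp(x), so that only the total of [T] matters. *)
apply: (@le_trans _ _ (\prod_(h < r) (r%:R * expR (2 * c * T h / r%:R)))).
  apply: ler_prod => h _; apply/andP; split.
    by apply: sumr_ge0 => j _; exact: expR_ge0.
  apply: (@le_trans _ _ (\sum_(j < r) (1 + 2 * (c * H h j)))).
    apply: ler_sum => j _; apply: expR_le1D2x.
    by have := H0 h j; have := H3 h j; nra.
  rewrite big_split/= sumr_const card_ord -!mulr_sumr -/(T h).
  apply: (@le_trans _ _ (r%:R * (1 + 2 * c * T h / r%:R))).
    have -> : r%:R * (1 + 2 * c * T h / r%:R) = r%:R + 2 * (c * T h).
      by field; rewrite gt_eqF.
    by [].
  by rewrite ler_wpM2l// expR_ge1Dx.
rewrite big_split/= prodr_const card_ord -expR_sum card_ffun card_ord natrX mulrC.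
rewrite ler_wpM2r ?exprn_ge0//.
(* As the total of [T] is at most 3r, the exponent is at most 6c, which [c <= 1 / 12] keeps below
   1/2. *)
apply: (@le_trans _ _ (expR (6 * c))); last first.
  by have -> : 12 * c = 2 * (6 * c) by [lra]; apply: expR_le1D2x; lra.
rewrite ler_expR -mulr_suml -mulr_sumr ler_pdivrMr//.
by nra.
Qed.
(* The steps are supported on the last half of the coordinates, so a
   signal is orthogonal to its own reversal. *)
Lemma sqdist_span1_signal_ge c s (x : R) :
  (forall k : 'I_(r * r), 2 * 4 ^ k <= d)%N ->
  \sum_i tnth (signal c s) i ^+ 2 <= 2 * \sum_i (tnth (signal c s) i - x) ^+ 2.
Proof.
move=> half; set v := tnth (signal c s).
have orth i : v i * v (rev_ord i) = 0.
  rewrite /v !tnth_signal mulrACA mulr_suml.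
  rewrite [X in _ * X]big1 ?mulr0// => g _; rewrite mulr_sumr big1// => h _.
  rewrite /step; have [h1|_] := leqP; last by rewrite !mul0r.
  have [h2|_] := leqP; last by rewrite mul0r mulr0.
  have := half (level s g); have := half (level s h); have := ltn_ord i.
  move: h1 h2 => /=; lia.
have rev (F : 'I_d -> R) : \sum_i F i = \sum_i F (rev_ord i).
  by rewrite (reindex_inj rev_ord_inj).
have -> : 2 * \sum_i (v i - x) ^+ 2 =
    \sum_i ((v i - x) ^+ 2 + (v (rev_ord i) - x) ^+ 2).
  by rewrite big_split/= -(rev (fun i => (v i - x) ^+ 2)); lra.
have : 2 * \sum_i v i ^+ 2 = \sum_i (v i ^+ 2 + v (rev_ord i) ^+ 2).
  by rewrite big_split/= -(rev (fun i => v i ^+ 2)); lra.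
have : \sum_i (v i ^+ 2 + v (rev_ord i) ^+ 2) <=
    2 * \sum_i ((v i - x) ^+ 2 + (v (rev_ord i) - x) ^+ 2).
  rewrite mulr_sumr; apply: ler_sum => i _.
  (* With a b = 0, the parallelogram identity reads 2((a - x)^2 + (b - x)^2) = a^2 + b^2 + (a + b -
     2x)^2. *)
  have := orth i; have := sqr_ge0 (v i + v (rev_ord i) - 2 * x); nra.
lra.
Qed.

End signal.


(* For d = 1 the cone and span(1) are both the whole line and no alternative is
   left, so the case L = span(1) is stated for d >= 2. *)
Theorem proposition2 (R : realType) :
  exists kappa : R -> R,
    (forall rho : R, 0 < rho <= 1 / 2 -> 0 < kappa rho) /\
    forall (rho : R) (d : nat) (sigma eps : R) (L : set (Rvec R d)),
      0 < rho <= 1 / 2 ->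
      0 < sigma ->
      0 < eps ->
      ((1 <= d)%N /\ L = zero_space R d) \/ ((2 <= d)%N /\ L = span1 R d) ->
      eps ^+ 2 <= kappa rho * sigma ^+ 2 * Num.sqrt (ln (expR 1 * d%:R)) ->
      (rho%:E <= minimax_error L (monotone_cone R d) sigma eps)%E.
Proof.
(* The squared distance of a signal to [L] is at least sigma^2 r / 128 (norm sigma^2 r / 64, halved
   for span(1)), while this constant gives eps^2 <= sigma^2 r / 256. *)
exists (fun=> 1 / 1024); split=> [rho _|rho d sigma eps L rho2 s0 e0 HL epsle].
  by lra.
have d1 : (1 <= d)%N by case: HL => -[]//; lia.
have [r [r1 rd rd2 sqrtr]] := group_count_exists (R := R) d1.
have L0 : L (nseq_tuple d 0).
  by case: HL => -[_ ->]; [|exists 0].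
have LE u : L u -> exists2 x, u = nseq_tuple d x & x = 0 \/ (2 <= d)%N.
  case: HL => -[dd ->]; first by move=> ->; exists 0; [|left].
  by move=> [x _ <-]; exists x; [|right].
have le_top (k : 'I_(r * r)) : (4 ^ k <= 4 ^ (r * r).-1)%N.
  by rewrite leq_pexp2l// -ltnS prednK ?muln_gt0 ?r1// ltn_ord.
have level_le (k : 'I_(r * r)) : (4 ^ k <= d)%N := leq_trans (le_top k) rd.
pose theta (s : {ffun 'I_r -> 'I_r}) : Rvec R d := signal d (sigma / 8) s.
have s2 : 0 < sigma ^+ 2 by rewrite exprn_gt0.
have far s : (monotone_cone R d `\` ball2 L eps) (theta s).
  split; first by apply: signal_monotone; lra.
  move=> [u /LE[x -> xd] [_]]; apply/negP; rewrite -ltNge.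
  have norm := sqnorm_signal_ge level_le (sigma / 8) s.
  have dist : \sum_i tnth (theta s) i ^+ 2 <=
      2 * \sum_i (tnth (theta s) i - tnth (nseq_tuple d x) i) ^+ 2.
    under [in leRHS]eq_bigr do rewrite tnth_nseq.
    (* At [x = 0] the factor 2 is to spare; otherwise [d >= 2] provides the half-support
       condition. *)
    case: xd => [->|/rd2 rd2'].
      under [in leRHS]eq_bigr do rewrite subr0.
      by rewrite ler_peMl ?ler1n//; apply: sumr_ge0 => i _; exact: sqr_ge0.
    apply: sqdist_span1_signal_ge => k.
    exact: leq_trans (leq_mul (leqnn 2) (le_top k)) rd2'.
  have r1' : 1 <= r%:R :> R by rewrite ler1n.
  have eps2 : eps ^+ 2 <= 1 / 1024 * sigma ^+ 2 * (4 * r%:R).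
    have k0 : 0 <= 1 / 1024 * sigma ^+ 2 by lra.
    exact: le_trans epsle (ler_wpM2l k0 sqrtr).
  have sr : 0 < sigma ^+ 2 * r%:R by rewrite mulr_gt0//; lra.
  have lt_dist :
      eps ^+ 2 < \sum_i (tnth (theta s) i - tnth (nseq_tuple d x) i) ^+ 2.
    by move: norm; rewrite -/(theta s) expr_div_n; lra.
  rewrite -[ltLHS]ger0_norm ?ltW// -sqrtr_sqr ltr_sqrt//.
  exact: le_lt_trans (sqr_ge0 eps) lt_dist.
apply: le_ereal_inf_tmp => _ [psi _ <-].
have K0 : (0 < #|{ffun 'I_r -> 'I_r}|)%N.
  by rewrite card_ffun card_ord expn_gt0 r1.
have [|k hk] := @mixture_lower_bound R d _ theta sigma psi s0 K0.
  (* The scale sigma / 8 gives c = 1/64, and 1 + 12/64 = 19/16 <= 5/4. *)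
  apply: (@le_trans _ _ (\sum_(s : {ffun 'I_r -> 'I_r})
      (1 + 12 * (1 / 64)) * #|{ffun 'I_r -> 'I_r}|%:R)).
    apply: ler_sum => s _.
    have scale G : (sigma / 8) ^+ 2 * G / sigma ^+ 2 = 1 / 64 * G.
      by field; rewrite gt_eqF.
    under eq_bigr do rewrite (sum_signal level_le) scale.
    by apply: sum_exp_signal => //; lra.
  rewrite sumr_const -(mulr_natr (_ * _)) -mulrA -expr2 ler_wpM2r ?sqr_ge0//; lra.
apply: (@le_trans _ _ (1 / 2)%:E); first by rewrite lee_fin; lra.
apply: le_trans hk _; apply: leeD.
  by apply: ereal_sup_ubound; exists (nseq_tuple d 0).
by apply: ereal_sup_ubound; exists (theta k) => //; exact: far.
Qed.
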